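(* Let $G$ be a finite solvable group such that $|\mathrm{cdc}(G)|=2$ and $\mathrm{dl}(G)=4$. Then there exists a normal abelian $3$-subgroup $N$ of $G$ such that $G/N\cong S_4$, and $\mathrm{cd}(G)\subseteq\{1,2,3,4,6,8,12\}$. In particular, $G$ contains an element of order $6$ and there exists $\chi\in\mathrm{Irr}(G)$ such that either $\chi(1)=6$ or $\chi(1)=12$.
   Context: $\mathrm{Irr}(G)$ denotes the set of complex irreducible characters of the finite group $G$. Define $\mathrm{cd}(G)=\{\chi(1)\mid \chi\in\mathrm{Irr}(G)\}$, $\mathrm{cv}(G)=\{\chi(g)\mid \chi\in\mathrm{Irr}(G),\ g\in G\}$ and $\mathrm{cdc}(G)=\mathrm{cv}(G)\setminus\mathrm{cd}(G)$. $\mathrm{dl}(G)$ denotes the derived length of the solvable group $G$, and $S_4$ is the symmetric group of degree $4$. *)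

(* Defs.v *)
From mathcomp Require Import all_boot all_order all_algebra.
From mathcomp Require Import all_fingroup all_solvable all_field all_character.

Set Implicit Arguments.
Unset Strict Implicit.
Unset Printing Implicit Defensive.

Import GroupScope GRing.Theory.
Local Open Scope ring_scope.

Section CharacterValues.

Variable gT : finGroupType.
Implicit Type G : {group gT}.

(* Finite sets of complex numbers are represented by duplicate-free sequences
   over algC, so that their cardinality is their size. *)
Definition cd G : seq algC := undup [seq 'chi[G]_i 1%g | i : Iirr G].

(* Elements outside G are excluded on purpose: a class function on G is
   extended by 0 to the rest of gT. *)
Definition cv G : seq algC :=
  undup [seq 'chi[G]_i g | i <- enum {: Iirr G}, g <- enum G].

Definition cdc G : seq algC := [seq x <- cv G | x \notin cd G].

Lemma cdP G x : reflect (exists i, x = 'chi[G]_i 1%g) (x \in cd G).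
Proof. by rewrite mem_undup; apply: codomP. Qed.

Lemma cvP G x :
  reflect (exists i, exists2 g, g \in G & x = 'chi[G]_i g) (x \in cv G).
Proof.
rewrite mem_undup; apply: (iffP allpairsP) => [[[i g] /= [_]]|[i [g Gg ->]]].
  by rewrite mem_enum => Gg ->; exists i, g.
by exists (i, g); rewrite !mem_enum.
Qed.

Lemma cdc_uniq G : uniq (cdc G).
Proof. by rewrite filter_uniq ?undup_uniq. Qed.

Lemma mem_cdc G x : (x \in cdc G) = (x \in cv G) && (x \notin cd G).
Proof. by rewrite mem_filter andbC. Qed.

(* The least n such that G^`(n) = 1, searched among n < #|G|, which suffices
   for solvable G; the value is #|G| if G is not solvable (compare nil_class). *)
Definition derived_length G : nat :=
  index 1%g (mkseq (fun n => G^`(n)%g) #|G|).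

Lemma card_der_solvable G n :
  solvable G -> G^`(n)%g != 1%g -> (n + #|G^`(n)%g| <= #|G|)%N.
Proof.
move=> solG; elim: n => [|n IHn] ntGn1; first by rewrite derg0.
have ntGn: G^`(n)%g != 1%g.
  by apply: contraNneq ntGn1 => Gn1; rewrite -subG1 -Gn1 der_subS.
apply: leq_trans (IHn ntGn); rewrite addSnnS leq_add2l proper_card //.
rewrite dergSn (sol_der1_proper solG) ?der_sub //.
Qed.

Lemma derived_lengthP G n :
  solvable G ->
  derived_length G = n <->
  G^`(n)%g = 1%g /\ forall m, (m < n)%N -> G^`(m)%g != 1%g.
Proof.
move=> solG; set s := mkseq (fun n => G^`(n)%g) #|G|.
have szs: size s = #|G| by rewrite size_mkseq.
have s1: 1%g \in s.
  have lt: (#|G|.-1 < #|G|)%N by rewrite prednK.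
  suff G1: G^`(#|G|.-1)%g = 1%g by rewrite -G1; apply/map_f; rewrite mem_iota.
  apply/eqP/contraT=> nt.
  have: (#|G|.-1 + 2 <= #|G|)%N.
    by apply: leq_trans (card_der_solvable solG nt); rewrite leq_add2l cardG_gt1.
  by rewrite addn2 prednK // ltnn.
have lts: (index 1%g s < #|G|)%N by rewrite -szs index_mem.
have minP m: (m < index 1%g s)%N -> G^`(m)%g != 1%g.
  move=> ltm; have := before_find 1%g ltm => /=.
  by rewrite nth_mkseq ?(ltn_trans ltm) // => /negbT.
have idx1: G^`(index 1%g s)%g = 1%g.
  by have := nth_index 1%g s1; rewrite nth_mkseq.
rewrite /derived_length -/s; split=> [<- // | [Gn1 ntG]].
case: (ltngtP (index 1%g s) n) => // [/ntG | /minP].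
  by rewrite idx1 eqxx.
by rewrite Gn1 eqxx.
Qed.

End CharacterValues.

(* Main.v *)
Require Import Defs.
From mathcomp Require Import all_boot all_order all_algebra.
From mathcomp Require Import all_fingroup all_solvable all_field all_character.
From mathcomp Require Import zify.

Set Implicit Arguments.
Unset Strict Implicit.
Unset Printing Implicit Defensive.

Import Order.TTheory GroupScope GRing.Theory Num.Theory.

(** The hypotheses are contradictory: no solvable group with exactly two
    character values outside its set of character degrees has derived length 4,
    so that the four conclusions hold vacuously.

    A nonlinear irreducible character vanishes somewhere, and a nonprincipal
    linear character takes a value that is a root of unity different from 1;
    neither value is a degree. So cdc G = {0, -1}, and every irreducible
    character takes integer values that are at least -1 (irr_geN1). This
    property passes to quotients and is used through three consequences. The
    group is rational (irr_geN1_rational). If it is not abelian, its center is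
    trivial (irr_geN1_center). Finally, let N be a normal p-subgroup that is not
    contained in the kernel of chi: on N the values of chi are congruent to
    chi(1) mod p, are at least -1 and have sum 0, hence chi(1) = -1 mod p
    (irr1_modp). It follows that normal p-subgroups are abelian
    (irr_geN1_pgroup_abelian) and, since chi(1) is even if chi is nontrivial on
    a normal subgroup of odd order, that nontrivial normal 2-subgroups and
    normal subgroups of odd order do not coexist (irr_geN1_no_mixed).

    The derived series is then determined from the top. If G is not abelian,
    then G / G'' is an elementary abelian 3-group extended by an involution that
    inverts it (irr_geN1_top). If G''' = 1 and G'' is nontrivial, then G'' is a
    Klein four group and |G| = 24, so that G resembles the symmetric group of
    degree 4 (dl3_der2_2group, dl3_der1_index, dl3_card_der2). Suppose that N =
    G''' is nontrivial and abelian. It has odd order, since otherwise a quotient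
    of G'' would be a nonabelian normal 2-subgroup. For every prime divisor p of
    |N|, some element w of order p of N has a centralizer in G'' that lies
    strictly between N and G''; an element of G that normalizes <w> then has a
    square that centralizes w, and rationality forces p = 3 (dl4_der3_3group).
    Dually, some nonprincipal linear character of N has an inertia group that
    meets G'' strictly between N and G'', so 3 divides the length of its orbit
    and the degree of every character of G above it, contrary to the congruence
    chi(1) = -1 mod 3 (dl4_false). *)

(** * Generalities on groups, characters and algebraic integers *)

Lemma prime_index_maximal (gT : finGroupType) (G K H : {group gT}) :
  prime #|G : K| -> K \subset H -> H \subset G -> ~~ (H \subset K) -> H :=: G.
Proof.
move=> pr_i sKH sHG nsHK; apply/eqP; rewrite eqEsubset sHG -indexg_eq1.
have iHK: #|H : K| != 1%N by rewrite indexg_eq1.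
have:= primeP pr_i; rewrite -(Lagrange_index sHG sKH).
case=> _ /(_ #|H : K|); rewrite dvdn_mull // (negPf iHK) /= => /(_ isT).
by rewrite -{1}[#|H : K|]mul1n eqn_pmul2r // eq_sym.
Qed.

Lemma coset_in_quotient (gT : finGroupType) (K H : {group gT}) x :
  K \subset H -> x \in 'N(K) -> (coset K x \in H / K) = (x \in H).
Proof.
move=> sKH Nx; apply/idP/idP=> [|Hx]; last by rewrite mem_quotient.
case/morphimP=> y Ny Hy /rcoset_kercosetP-/(_ Nx Ny)/rcosetP[z Kz ->].
by rewrite groupM // (subsetP sKH).
Qed.

Lemma card2_cents (gT : finGroupType) (A H : {group gT}) :
  #|H| = 2 -> A \subset 'N(H) -> A \subset 'C(H).
Proof.
move=> oH nHA; apply/centsP=> a Aa y Hy; have [-> | nt_y] := eqVneq y 1.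
  by rewrite /commute mulg1 mul1g.
have defH : [set 1; y] = H.
  by apply/eqP; rewrite eqEcard subUset !sub1set group1 Hy cards2 eq_sym nt_y oH.
have: y ^ a \in H by rewrite memJ_norm // (subsetP nHA).
rewrite -defH !inE conjg_eq1 (negPf nt_y) => /eqP ya.
by rewrite /commute [RHS]conjgC ya.
Qed.

(** Otherwise A would act faithfully on a minimal A-invariant subgroup of V,
    which is an irreducible module; an abelian group with a faithful irreducible
    representation is cyclic. *)
Lemma cent_noncyclic_abelian (gT : finGroupType) (A V : {group gT}) :
  abelian A -> ~~ cyclic A -> A \subset 'N(V) -> solvable V -> V :!=: 1%g ->
  exists2 a, a \in A^# & 'C_V[a] != 1%g.
Proof.
move=> abA ncA nVA solV ntV; have [M minM sMV] := minnormal_exists ntV nVA.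
have solM := solvableS sMV solV.
have [_ ntM /is_abelemP[p p_pr abelM]] := minnormal_solvable minM sMV solV.
have [/andP[_ nMA] _] := mingroupP minM.
pose rG := abelem_repr abelM ntM nMA.
have irrG : mx_irreducible rG by apply/abelem_mx_irrP.
have: ~~ mx_faithful rG.
  by apply: contra ncA => ffG; apply: mx_faithful_irr_abelian_cyclic ffG irrG abA.
rewrite /mx_faithful rker_abelem => /subsetPn[a /setIP[Aa cMa] nt_a].
exists a; first by move: nt_a; rewrite !inE Aa andbT.
apply/eqP=> tiVa; case/negP: (ntM); apply/eqP/trivgP; by rewrite -tiVa subsetI sMV sub_cent1.
Qed.

Lemma mem_irr_kerPn (gT : finGroupType) (G N : {group gT}) :
  N \subset G -> N :!=: 1%g -> exists i, ~~ (N \subset cfker ('chi[G]_i)%R).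
Proof.
move=> sNG ntN; apply/existsP; apply: contraR ntN; rewrite negb_exists => /forallP kN.
rewrite -subG1 -(TI_cfker_irr G); apply/bigcapsP=> i _.
exact: negbNE (kN i).
Qed.

(** Clifford's theorem: the restriction to N is a multiple of the sum over the
    G-orbit of 'chi_j, whose length is the index of the inertia group. *)
Lemma dvdn_index_Inertia (gT : finGroupType) (G N : {group gT}) i j d :
    N <| G -> j \in irr_constt ('Res[N, G] 'chi_i)%R ->
  ('chi_i 1%g = d%:R)%R -> #|G : 'I_G[('chi_j)%R]| %| d.
Proof.
move=> nsNG cij Dd; have sNG := normal_sub nsNG.
have: ('Res[N] 'chi_i 1%g = d%:R)%R by rewrite cfRes1.
rewrite {1}(Clifford_Res_sum_cfclass nsNG cij) cfunE sum_cfunE.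
have /natrP[e ->] : ('['Res[N] 'chi_i, 'chi_j] \in Num.nat)%R.
  by rewrite Cnat_cfdot_char ?cfRes_char ?irr_char.
have /natrP[f Df] := Cnat_irr1 j.
rewrite big_tnth (eq_bigr (fun _ => f%:R)%R) => [|k _]; last first.
  by have /cfclassP[y Gy ->] := mem_tnth k (in_tuple (('chi_j)%R ^: G)%CF); rewrite cfConjg1.
rewrite sumr_const card_ord size_cfclass -mulrnA -natrM => /eqP.
by rewrite eqr_nat => /eqP<-; rewrite mulnA dvdn_mull.
Qed.

Section Congruence.

Local Open Scope ring_scope.

Lemma Aint_natr n : n%:R \in Aint.
Proof. by rewrite Aint_Cnat. Qed.

Lemma eqAmod_exp_prime_sum (p : nat) (I : Type) (r : seq I) (F : I -> algC) :
  prime p -> (forall i, F i \in Aint) ->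
  ((\sum_(i <- r) F i) ^+ p == \sum_(i <- r) F i ^+ p %[mod p])%A.
Proof.
move=> p_pr AF; elim: r => [|i r IHr].
  by rewrite !big_nil expr0n gtn_eqF ?prime_gt0.
rewrite !big_cons; set x := F i; set y := \sum_(j <- r) F j in IHr *.
have Ax: x \in Aint by apply: AF.
have Ay: y \in Aint by apply: rpred_sum => j _; apply: AF.
apply: eqAmod_trans (_ : (x ^+ p + y ^+ p == _ %[mod _])%A); last first.
  by apply: eqAmodD => //; apply: eqAmod_refl.
rewrite exprDn; case: p p_pr {IHr} => // q p_pr.
rewrite big_ord_recl big_ord_recr /= subn0 expr0 mulr1 bin0 mulr1n /bump /= add1n.
rewrite subnn expr0 mul1r binn mulr1n eqAmodDl -[X in (_ == X %[mod _])%A]add0r eqAmodDr.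
rewrite eqAmod0; apply: rpred_sum => j _; rewrite -[_ \in _]eqAmod0.
have /dvdnP[k ->]: (q.+1 %| 'C(q.+1, 1 + j))%N.
  by apply: prime_dvd_bin => //; rewrite add1n /= ltnS.
rewrite mulrnA -mulr_natr; apply: eqAmodMl0.
by rewrite -mulr_natr !(rpredM, rpredX, Aint_natr).
Qed.

Lemma eqAmod_exp (p : nat) k x y : x \in Aint -> y \in Aint ->
  (x == y %[mod p])%A -> (x ^+ k == y ^+ k %[mod p])%A.
Proof.
move=> Ax Ay exy; elim: k => [|k IHk]; first by rewrite !expr0 eqAmod_refl.
by rewrite !exprS; apply: eqAmodM; rewrite ?rpredX.
Qed.

(** If x has order q = p ^ k, then phi x is a sum of phi 1 roots of unity of
    order dividing q, so the binomial theorem gives phi x ^ q = phi 1 mod p,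
    whereas n ^ q = n mod p by Fermat. Only values that are natural numbers are
    needed: characters with values at least -1 are used after adding the
    principal one. *)
Lemma p_elt_char_nat (gT : finGroupType) (G : {group gT}) (phi : 'CF(G))
    (p : nat) x n d :
  prime p -> phi \is a character -> x \in G -> p.-elt x ->
  phi x = n%:R -> phi 1%g = d%:R -> n = d %[mod p].
Proof.
move=> p_pr /char_reprP[rG Dphi] Gx px phix phi1.
have [e [_ [e1 _] [phixE _] _]] := repr_rsim_diag rG Gx.
have [k Dk] := p_natP px.
have Ae i : e 0 i \in Aint.
  by rewrite (@Aint_unity_root #[x]) ?order_gt0 //; apply/unity_rootP.
have iterF j: ((\sum_i e 0 i) ^+ (p ^ j) == \sum_i e 0 i ^+ (p ^ j) %[mod p])%A.
  elim: j => [|j IHj]; first by under [X in (_ == X %[mod _])%A]eq_bigr do rewrite expn0; rewrite expn0 eqAmod_refl.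
  rewrite expnS mulnC exprM; under [X in (_ == X %[mod _])%A]eq_bigr do rewrite exprM.
  apply: eqAmod_trans (eqAmod_exp_prime_sum _ p_pr _) => [|i]; last by rewrite rpredX.
  by apply: eqAmod_exp IHj; rewrite ?rpredX ?rpred_sum // => i _; rewrite ?rpredX.
have:= iterF k; rewrite -Dk -phixE -Dphi phix.
under [X in (_ == X %[mod _])%A]eq_bigr do rewrite e1.
rewrite sumr_const card_ord -natrX eqAmod_nat.
have ->: rdegree rG = d.
  by apply/eqP; rewrite -(eqr_nat algC) -phi1 Dphi cfRepr1.
move/eqP<-; rewrite Dk; elim: (k) => [|j IHj] //.
by rewrite expnS mulnC expnM fermat_little.
Qed.

End Congruence.

(** * Characters whose values are integers at least -1 *)

(** The condition on character values that governs the whole proof, in a form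
    that quotients inherit. *)
Definition irr_geN1 (gT : finGroupType) (G : {group gT}) :=
  forall i g, g \in G -> exists n, ('chi[G]_i g = n%:R - 1)%R.

Section IntegerValues.

Local Open Scope ring_scope.

Variables (gT : finGroupType) (G : {group gT}).
Hypothesis PG : irr_geN1 G.

Lemma irr_geN1_int i g : 'chi[G]_i g \in Num.int.
Proof.
have [/(PG i)[n ->] | /cfun0->//] := boolP (g \in G).
by rewrite rpredB ?rpred1 ?rpred_nat.
Qed.

Lemma irr_geN1_le i g : -1 <= 'chi[G]_i g.
Proof.
have [/(PG i)[n ->] | /cfun0->] := boolP (g \in G); last by rewrite lerN10.
by rewrite lerBrDr addNr ler0n.
Qed.

Lemma irr_geN1_mod (N : {group gT}) : N <| G -> irr_geN1 (G / N)%G.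
Proof.
move=> nsNG i _ /morphimP[g Ng Gg ->].
by have [n] := PG (@mod_Iirr _ G N i) Gg; rewrite mod_IirrE // cfModE //; exists n.
Qed.

(** Multiplication by a linear character that takes the value -1 at t changes
    the sign of the value at t. *)
Lemma irr_geN1_norm_le1 l i t :
  'chi[G]_l \is a linear_char -> 'chi_l t = -1 -> `|'chi[G]_i t| <= 1.
Proof.
move=> lin_l lt; have le1 := irr_geN1_le i t.
have /irrP[j Dj]: 'chi_l * 'chi_i \in irr G by rewrite mul_lin_irr ?mem_irr.
have:= irr_geN1_le j t; rewrite -Dj cfunE lt mulN1r lerN2 => le2.
have Rx : 'chi_i t \is Num.real by rewrite Rreal_int ?irr_geN1_int.
by rewrite real_ler_norml // le1.
Qed.

(** A central z acts on a nonlinear chi by a scalar of modulus 1, and -chi(1) <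
    -1 is not a value, so z lies in the kernel of chi. The product of chi with a
    linear character is again nonlinear, so z lies in the kernel of that linear
    character too. *)
Lemma irr_geN1_center : ~~ abelian G -> 'Z(G) = 1%g.
Proof.
move=> not_cGG; have [i nlin_i]: exists i, ~~ ('chi[G]_i \is a linear_char).
  by apply/existsP; apply: contraR not_cGG; rewrite negb_exists => /forallP lin;
    apply/char_abelianP=> i; apply: negbNE (lin i).
have nlin_ker j z : ~~ ('chi[G]_j \is a linear_char) -> z \in 'Z(G) -> 'chi_j z = 'chi_j 1%g.
  move=> nlin_j Zz; have Gz : z \in G by apply: subsetP Zz; apply: center_sub.
  have: z \in 'Z('chi_j)%CF.
    by apply: subsetP Zz; rewrite -cap_cfcenter_irr; apply: bigcap_inf.
  rewrite irr_cfcenterE // => /eqP.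
  have [n] := PG j Gz; have /natrP[d Dd] := Cnat_irr1 j.
  move: nlin_j; rewrite qualifE /= irr_char Dd /= => d_neq1.
  case: n => [|n] ->; last by rewrite -natr1 addrK normr_nat.
  rewrite sub0r normrN1 => d1; by rewrite -d1 eqxx in d_neq1.
apply/trivgP; rewrite -(TI_cfker_irr G); apply/subsetP=> z Zz.
have Gz : z \in G by apply: subsetP Zz; apply: center_sub.
apply/bigcapP=> l _; rewrite cfkerEirr inE.
have [lin_l | /nlin_ker->//] := boolP ('chi_l \is a linear_char).
have /irrP[j Dj]: 'chi_l * 'chi_i \in irr G by rewrite mul_lin_irr ?mem_irr.
have nlin_j: ~~ ('chi_j \is a linear_char).
  by move: nlin_i; rewrite !qualifE /= !irr_char /= -Dj cfunE [X in X * _]lin_char1 ?mul1r.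
have:= nlin_ker j z nlin_j Zz; rewrite -Dj !cfunE (nlin_ker i) //.
by move/(mulIf (irr1_neq0 i))->.
Qed.

(** The Galois automorphism that raises roots of unity of order #[x] to the
    power k maps chi x to chi (x ^+ k), and it fixes chi x, which is an integer.
    *)
Lemma irr_geN1_rational x k : x \in G -> coprime k #[x] -> (x ^+ k)%g \in x ^: G.
Proof.
move=> Gx co_k_x; apply/eq_irr_mem_classP => // i.
have [u Du] := Qn_aut_exists co_k_x.
have sxG: <[x]> \subset G by rewrite cycle_subG.
have uE: u ('chi_i x) = 'chi_i x.
  by have /intrP[m ->] := irr_geN1_int i x; rewrite rmorph_int.
rewrite -[RHS]uE -!(cfResE _ sxG) ?cycle_id ?mem_cycle //.
have /char_sum_irrP[n ->]: 'Res[<[x]>] 'chi_i \is a character by rewrite cfRes_char ?irr_char.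
rewrite !sum_cfunE rmorph_sum; apply: eq_bigr => j _.
rewrite !cfunE rmorphM rmorph_nat.
have lin_j: 'chi_j \is a linear_char by apply/char_abelianP; rewrite cycle_abelian.
rewrite Du ?lin_charX ?cycle_id //.
by rewrite -lin_charX ?cycle_id // expg_order lin_char1.
Qed.

Lemma sum_cfker_irr0 (N : {group gT}) i :
  N <| G -> ~~ (N \subset cfker 'chi[G]_i) -> \sum_(n in N) 'chi_i n = 0.
Proof.
move=> nsNG; apply: contraNeq => nz; apply: constt0_Res_cfker => //.
rewrite irr_consttE cfdotE irr0 mulf_neq0 ?invr_eq0 ?neq0CG //.
apply: contraNneq nz => s0; rewrite -{}[X in _ == X]s0; apply/eqP/eq_bigr=> n Nn.
by rewrite cfResE ?normal_sub // cfun1E Nn conjC1 mulr1.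
Qed.

(** If p does not divide chi(1) + 1, then no value on N is -1, so the values of
    chi on N are nonnegative; their sum is 0 because the restriction of chi to N
    has no principal constituent, yet chi(1) > 0. *)
Lemma irr1_modp (N : {group gT}) (p : nat) i d :
  prime p -> N <| G -> p.-group N -> ~~ (N \subset cfker 'chi[G]_i) ->
  'chi_i 1%g = d%:R -> (p %| d.+1)%N.
Proof.
move=> p_pr nsNG pN nkN Dd; apply: contraT => not_pd.
have [sNG _] := andP nsNG.
have ge0 n : n \in N -> 0 <= 'chi_i n.
  move=> Nn; have Gn := subsetP sNG n Nn; have [m Dm] := PG i Gn.
  (* The character chi + 1 has the natural number value m at n. *)
  have: m = d.+1 %[mod p].
    apply: (@p_elt_char_nat _ G ('chi_i + 1) p n); rewrite ?(mem_p_elt pN) //.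
    - by rewrite rpredD ?irr_char ?rpred1.
    - by rewrite !cfunE Dm cfun1E Gn subrK.
    by rewrite !cfunE Dd cfun1E group1 natr1.
  case: m Dm => [|m ->]; last by rewrite -natr1 addrK ler0n.
  by move=> _ /esym/eqP; rewrite mod0n -/(dvdn _ _) (negPf not_pd).
have:= sum_cfker_irr0 nsNG nkN; rewrite (bigD1 1%g) //= => /eqP.
rewrite paddr_eq0 ?ge0 // ?(negPf (irr1_neq0 i)) //.
by apply: sumr_ge0 => n /andP[/ge0].
Qed.

(** The sum of chi over N is 0, and the elements other than 1 are matched in
    pairs {n, n^-1} on which chi takes equal integer values. *)
Lemma irr1_even (N : {group gT}) i d :
  N <| G -> odd #|N| -> ~~ (N \subset cfker 'chi[G]_i) ->
  'chi_i 1%g = d%:R -> ~~ odd d.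
Proof.
move=> nsNG oddN nkN Dd; pose lt (n : gT) := (enum_rank n < enum_rank n^-1%g)%N.
pose F n := 'chi[G]_i n; have intF n : F n \in Num.int by apply: irr_geN1_int.
have FV n : F n^-1%g = F n by rewrite /F irr_inv conj_intr.
have:= sum_cfker_irr0 nsNG nkN; rewrite (bigD1 1%g) //= Dd (bigID lt) /=.
rewrite [X in _ + (_ + X)](_ : _ = \sum_(n in N | (n != 1%g) && lt n) F n); last first.
  (* An element of odd order that equals its inverse is trivial. *)
  rewrite (reindex_inj invg_inj); apply: eq_big => [n | n _]; last exact: FV.
  rewrite groupV invg_eq1 /lt invgK -leqNgt -andbA; case: (boolP (n \in N)) => //= Nn.
  have [//|nt_n /=] := eqVneq n 1%g; rewrite leq_eqVlt.
  case: eqP => // /ord_inj/enum_rank_inj nV; case/eqP: nt_n.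
  apply/eqP; rewrite -order_eq1 -dvdn1 -(eqnP (_ : coprime 2 #|N|)); last by rewrite coprime2n.
  by rewrite dvdn_gcd order_dvdG // order_dvdn expgS expg1 {1}nV mulVg eqxx.
under eq_bigl do rewrite -andbA.
have /intrP[m ->]: \sum_(n in N | (n != 1%g) && lt n) F n \in Num.int.
  by apply: rpred_sum => n _.
move/eqP; rewrite -[d%:R]/((d : int)%:~R) -!rmorphD /= intr_eq0 addr_eq0 => /eqP Dd2.
apply/negP=> odd_d; have: odd (absz (d : int)) by [].
by rewrite Dd2 abszN -mulr2n -mulr_natr abszM oddM andbF.
Qed.

End IntegerValues.

Section NormalSubgroups.

Local Open Scope ring_scope.

Variables (gT : finGroupType) (G : {group gT}).
Hypothesis PG : irr_geN1 G.
Implicit Types N V O : {group gT}.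

(** A character chi that is nontrivial on the derived subgroup of N has degree
    prime to p, so the constituents of its restriction to the p-group N, whose
    degrees are powers of p that divide chi(1), are linear. *)
Lemma irr_geN1_pgroup_abelian N (p : nat) :
  prime p -> N <| G -> p.-group N -> abelian N.
Proof.
move=> p_pr nsNG pN; rewrite (sameP derG1P eqP); apply: contraT => ntN'.
have nsN'G : N^`(1)%G <| G by apply: char_normal_trans nsNG; apply: der_char.
have [i nkN'] := mem_irr_kerPn (normal_sub nsN'G) ntN'.
have nkN : ~~ (N \subset cfker 'chi_i) by apply: contra nkN'; apply: subset_trans (der_sub 1 N).
have /natrP[d Dd] := Cnat_irr1 i.
have p_d1 := irr1_modp PG p_pr nsNG pN nkN Dd.
case/negP: nkN'; have [sNG _] := andP nsNG.
suffices: N^`(1)%g \subset cfker ('Res[N] 'chi_i).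
  by rewrite cfker_Res ?irr_char // subsetI => /andP[].
rewrite cfkerE ?cfRes_char ?irr_char // subsetI der_sub.
apply/bigcapsP=> j /(dvdn_constt_Res1_irr1 nsNG)[n]; rewrite Dd => Dn.
apply: lin_char_der1; rewrite qualifE /= irr_char.
have /natrP[e De] := Cnat_irr1 j; rewrite De in Dn |- *.
have e_d : (e %| d)%N by rewrite -natrM in Dn; move/eqP: Dn; rewrite eqr_nat => /eqP->; rewrite dvdn_mull.
have e_N : (e %| #|N|)%N by have:= dvd_irr1_cardG j; rewrite De dvdC_nat.
have [[|k] De1] := p_natP (pnat_dvd e_N pN); first by rewrite De1 expn0 eqxx.
have p_d : (p %| d)%N by apply: dvdn_trans e_d; rewrite De1 expnS dvdn_mulr.
by move: p_d1; rewrite -addn1 dvdn_addr // dvdn1 => /eqP p1; rewrite p1 in p_pr.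
Qed.

(** A character of G above the product of nontrivial characters of V and of O
    would have an odd degree because of V and an even one because of O. *)
Lemma irr_geN1_no_mixed V O :
  V <| G -> O <| G -> 2%N.-group V -> odd #|O| -> V :!=: 1%g -> O :=: 1%g.
Proof.
move=> nsVG nsOG v2 oddO ntV; apply/eqP; apply: contraT => ntO.
have coVO : coprime #|V| #|O| by apply: pnat_coprime v2 _; rewrite -odd_2'nat.
have tiVO := coprime_TIg coVO.
have cVO : O \subset 'C(V).
  have [[sVG nVG] [sOG nOG]] := (andP nsVG, andP nsOG).
  rewrite centsC; apply/commG1P/trivgP; rewrite -tiVO subsetI commg_subl commg_subr.
  by rewrite (subset_trans sOG nVG) (subset_trans sVG nOG).
have defVO : V \x O = (V <*> O)%G by apply: dprodEY.
have [i nki] := mem_irr_kerPn (subxx V) ntV.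
have [j nkj] := mem_irr_kerPn (subxx O) ntO.
pose k := dprod_Iirr defVO (i, j).
have sVOG : V <*> O \subset G by rewrite join_subG !normal_sub.
have [a] := constt_cfInd_irr k sVOG; rewrite constt_Ind_Res => ka.
have kera: V <*> O :&: cfker 'chi_a \subset cfker 'chi_k.
  rewrite -cfker_Res ?irr_char //; apply: cfker_constt ka.
  by rewrite cfRes_char ?irr_char.
have kE v o : v \in V -> o \in O -> 'chi_k (v * o)%g = 'chi_i v * 'chi_j o.
  by move=> Vv Oo; rewrite dprod_IirrE cfDprodE.
have k1 : 'chi_k 1%g = 'chi_i 1%g * 'chi_j 1%g by rewrite -kE // mulg1.
have /natrP[d Dd] := Cnat_irr1 a.
have nkV : ~~ (V \subset cfker 'chi_a).
  apply: contra nki => kV; apply/subsetP=> v Vv; rewrite cfkerEirr inE.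
  have: v \in cfker 'chi_k.
    by apply: (subsetP kera); rewrite inE (subsetP kV) // mem_gen // inE Vv.
  rewrite cfkerEirr inE k1 -[v]mulg1 kE // mulg1.
  by move=> /eqP/(mulIf (irr1_neq0 j))->.
have nkO : ~~ (O \subset cfker 'chi_a).
  apply: contra nkj => kO; apply/subsetP=> v Ov; rewrite cfkerEirr inE.
  have: v \in cfker 'chi_k.
    by apply: (subsetP kera); rewrite inE (subsetP kO) // mem_gen // inE Ov orbT.
  rewrite cfkerEirr inE k1 -[v]mul1g kE // mul1g.
  by move=> /eqP/(mulfI (irr1_neq0 i))->.
have := irr1_modp PG (isT : prime 2) nsVG v2 nkV Dd.
by rewrite dvdn2 /= negbK; apply: contraLR => _; apply: irr1_even nkO Dd.
Qed.

(** By rationality some g in G induces on <[x]> a generator of its cyclic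
    automorphism group, which has order #[x].-1. *)
Lemma irr_geN1_prime_gen x :
    x \in G -> prime #[x] ->
  exists g, [/\ g \in G, (x ^ g)%g \in <[x]>
    & forall e, (x ^ (g ^+ e))%g = x -> (#[x].-1 %| e)%N].
Proof.
move=> Gx p_pr; have /cyclicP[f defA] := Aut_prime_cycle_cyclic p_pr.
have Af : f \in Aut <[x]> by rewrite defA cycle_id.
have of_ : #[f] = #[x].-1 by rewrite /order -defA card_Aut_cycle totient_prime.
have fE y : y \in <[x]> -> f y = autm Af y by rewrite autmE.
have fx : f x \in <[x]> by rewrite Aut_closed ?cycle_id.
have /cycleP[k Dk] := fx.
have co_k : coprime k #[x].
  rewrite coprime_sym -generator_coprime /generator eq_sym eqEcard cycle_subG mem_cycle.
  rewrite -!orderE -Dk fE ?cycle_id // order_injm ?injm_autm ?cycle_id ?leqnn //.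
have /imsetP[g Gg Dg] := irr_geN1_rational PG Gx co_k.
exists g; split=> //; first by rewrite -Dg mem_cycle.
have fJ y : y \in <[x]> -> f y = (y ^ g)%g.
  case/cycleP=> i ->; rewrite conjXg -Dg -Dk.
  by rewrite !fE ?mem_cycle ?cycle_id // morphX ?cycle_id.
move=> e xge; rewrite -of_ order_dvdn.
have Afe : (f ^+ e)%g \in Aut <[x]> by rewrite groupX.
have feJ j : (f ^+ j)%g x = (x ^ (g ^+ j))%g.
  elim: j => [|j IHj]; first by rewrite !expg0 perm1 conjg1.
  rewrite !expgSr permM conjgM -IHj; apply: fJ.
  by rewrite Aut_closed ?cycle_id // groupX.
apply/eqP/(eq_Aut Afe (group1 _)) => y /cycleP[i ->].
by rewrite perm1 -(autmE Afe) morphX ?cycle_id //= autmE feJ xge.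
Qed.

End NormalSubgroups.

(** * The top two factors of the derived series *)

(** By rationality x^-1 = x ^ g for some g, and then x ^- 2 = [~ x, g]. *)
Lemma irr_geN1_sqr_der1 (gT : finGroupType) (G : {group gT}) x :
  irr_geN1 G -> x \in G -> x ^+ 2 \in G^`(1).
Proof.
move=> PG Gx; have co: coprime #[x].-1 #[x] by rewrite coprimePn.
have /imsetP[g Gg] := irr_geN1_rational PG Gx co.
rewrite -[x ^+ _](mulKg x) -expgS prednK // expg_order mulg1 => xg.
have: [~ x, g] \in G^`(1) by rewrite mem_commg.
by rewrite commgEl -xg -invMg groupV.
Qed.

Section Metabelian.

Variables (gT : finGroupType) (Q : {group gT}).
Hypotheses (PQ : irr_geN1 Q) (abQ' : abelian Q^`(1)) (ntQ' : Q^`(1) != 1).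

Lemma metab_2group : 2.-group (Q / Q^`(1)).
Proof.
apply: abelem_pgroup; apply: exponent2_abelem; apply/exponentP=> _ /morphimP[x Nx Qx ->].
by rewrite -morphX //= coset_id ?irr_geN1_sqr_der1.
Qed.

(** Modulo its odd part the derived subgroup is a 2-group, so the quotient of Q
    is a 2-group; a nontrivial 2-group has a nontrivial center, hence that
    quotient is abelian. *)
Lemma metab_der1_odd : odd #|Q^`(1)|.
Proof.
pose K := 'O_2^'(Q^`(1))%G.
have chK: K \char Q^`(1) by apply: pcore_char.
have nsKQ: K <| Q by apply: char_normal_trans chK (der_normal 1 Q).
have [sKQ nKQ] := andP nsKQ.
have hallK: 2^'.-Hall(Q^`(1)) K.
  by apply: (@nilpotent_pcore_Hall _ 2^' Q^`(1)%G); apply: abelian_nil.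
have [sKQ' oK iK] := and3P hallK.
suffices sQ'K: Q^`(1) \subset K by rewrite odd_2'nat; apply: pgroupS oK.
apply: (der1_min nKQ); apply: contraT => nabQK.
have p2: 2.-group (Q / K).
  rewrite /pgroup card_quotient // -(Lagrange_index (der_sub 1 Q) sKQ') pnatM.
  rewrite -card_quotient ?der_norm // [2.-nat _]metab_2group /=.
  by rewrite (eq_pnat _ (negnK 2)) in iK.
have PQK := irr_geN1_mod PQ nsKQ.
have := irr_geN1_center PQK nabQK => /(trivg_center_pgroup p2) QK1.
by rewrite QK1 abelian1 in nabQK.
Qed.

(** A Sylow 2-subgroup S of Q is an elementary abelian complement of the derived
    subgroup. Were it noncyclic, some nontrivial s in S would have nontrivial
    fixed points on Q^`(1), and s would become central in the nonabelian
    quotient by [~: Q^`(1), <[s]>]. *)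
Lemma metab_index : #|Q : Q^`(1)| = 2.
Proof.
have [S sylS] := Sylow_exists 2 Q.
have [sSQ pS _] := and3P sylS.
have nsQ'Q := der_normal 1 Q; have nQ'Q := der_norm 1 Q.
have defQ: Q^`(1) ><| S = Q.
  apply/(sdprod_normal_p'HallP nsQ'Q (_ : (2^')^'.-Hall(Q) S)).
    by rewrite (eq_pHall _ _ (negnK 2)).
  rewrite /pHall der_sub /pgroup -odd_2'nat metab_der1_odd /= -card_quotient //.
  by rewrite (eq_pnat _ (negnK 2)) [_.-nat _]metab_2group.
have [_ mulQ'S nQ'S tiQ'S] := sdprodP defQ.
have abelS: 2.-abelem S.
  apply: exponent2_abelem; apply/exponentP=> x Sx; apply/set1gP.
  by rewrite -tiQ'S inE irr_geN1_sqr_der1 ?(subsetP sSQ) // groupX.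
have abS := abelem_abelian abelS.
rewrite -(index_sdprod defQ); apply: cyclic_abelem_prime abelS _ _; last first.
  apply: contraNneq ntQ' => S1; move: mulQ'S; rewrite S1 mulg1 => Q'Q.
  by rewrite (sameP eqP derG1P) -Q'Q.
apply: contraT => ncS.
have [s /setD1P[nt_s Ss]] := cent_noncyclic_abelian abS ncS nQ'S (abelian_sol abQ') ntQ'.
case/negP; rewrite -subG1 /=.
pose K := [~: Q^`(1), <[s]>]%G.
have ssS: <[s]> \subset S by rewrite cycle_subG.
have ssN: <[s]> \subset 'N(Q^`(1)) := subset_trans ssS nQ'S.
have sKQ': K \subset Q^`(1) by rewrite commg_subl.
have nKQ: Q \subset 'N(K).
  rewrite -mulQ'S mulG_subG commg_norml normsR // cents_norm //.
  exact: subset_trans abS (centS ssS).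
have nsKQ: K <| Q by rewrite /normal (subset_trans sKQ' (der_sub 1 Q)).
have [abQK | nabQK] := boolP (abelian (Q / K)).
  have sQ'K := der1_min nKQ abQK.
  rewrite -cent_cycle -(@coprime_abel_cent_TI _ <[s]> Q^`(1)) //.
    exact: setSI.
  by rewrite coprime_sym (pnat_coprime (pgroupS ssS pS)) // -odd_2'nat metab_der1_odd.
have ZQK := irr_geN1_center (irr_geN1_mod PQ nsKQ) nabQK.
have nKs: <[s]> \subset 'N(K) := subset_trans ssS (subset_trans sSQ nKQ).
have: <[s]> / K \subset 'Z(Q / K).
  rewrite subsetI quotientS ?(subset_trans ssS) //=.
  rewrite -[in X in 'C(X / _)]mulQ'S quotientMl ?(subset_trans (der_sub 1 Q)) //.
  rewrite centM subsetI (quotient_cents2 nKs) ?(subset_trans (der_sub 1 Q)) // commGC subxx.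
  by rewrite quotient_cents // (subset_trans ssS).
rewrite ZQK quotient_sub1 // => ssK; case/eqP: nt_s; apply/set1gP.
by rewrite -tiQ'S inE Ss (subsetP sKQ') // (subsetP ssK) ?cycle_id.
Qed.

(** The product x * x ^ g is centralized by g and by Q^`(1), which together
    generate Q, so it lies in the trivial center of Q. *)
Lemma metab_invert x g : x \in Q^`(1) -> g \in Q :\: Q^`(1) -> x ^ g = x^-1.
Proof.
move=> Q'x /setDP[Qg nQ'g].
have Z1 := irr_geN1_center PQ _; have {Z1} Z1: 'Z(Q) = 1.
  by apply: Z1; apply: contraNN ntQ' => /derG1P->.
have cent1 y : y \in Q^`(1) -> y ^ g = y -> y = 1.
  move=> Q'y yg; apply/set1gP; rewrite -Z1 inE (subsetP (der_sub 1 Q)) //=.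
  rewrite -sub_cent1; apply/setIidPl.
  apply: (@prime_index_maximal _ Q Q^`(1)%G 'C_Q[y]%G).
  - by rewrite metab_index.
  - rewrite subsetI der_sub sub_cent1; exact: (subsetP abQ').
  - exact: subsetIl.
  apply/subsetPn; exists g => //; rewrite inE Qg /=; apply/cent1P.
  by rewrite /commute [y * g]conjgC yg.
have Ng: g \in 'N(Q^`(1)) by apply: subsetP Qg; apply: der_norm.
have Q'xg : x ^ g \in Q^`(1) by rewrite memJ_norm.
suffices xxg: x * x ^ g = 1 by apply/eqP; rewrite eq_sym eq_invg_mul xxg.
apply: cent1; first by rewrite groupM.
rewrite conjMg -conjgM -expg2 (centsP abQ' x) //.
congr (_ * _); rewrite conjgE -[x * _](centsP abQ' _ (irr_geN1_sqr_der1 PQ Qg)) // mulKg //.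
Qed.

Lemma metab_sqr g : g \in Q :\: Q^`(1) -> g ^+ 2 = 1.
Proof.
move=> QDg; have [Qg _] := setDP QDg.
have Q'g2 := irr_geN1_sqr_der1 PQ Qg.
have := metab_invert Q'g2 QDg; rewrite conjXg [g ^ g]conjgE mulKg => /esym/eqP.
rewrite eq_invg_mul => /eqP g4.
have: #[g ^+ 2] %| gcdn 2 #|Q^`(1)|.
  by rewrite dvdn_gcd order_dvdG // order_dvdn expg2 g4 eqxx.
rewrite (eqnP (_ : coprime 2 _)) ?coprime2n ?metab_der1_odd //.
by rewrite dvdn1 order_eq1 => /eqP.
Qed.

(** By rationality x ^+ 2 is conjugate to x, and the conjugates of x are x and
    x^-1. *)
Lemma metab_cube x : x \in Q^`(1) -> x ^+ 3 = 1.
Proof.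
move=> Q'x; have Qx := subsetP (der_sub 1 Q) x Q'x.
have co: coprime 2 #[x].
  by rewrite coprime2n (dvdn_odd (order_dvdG Q'x)) ?metab_der1_odd.
have /imsetP[g Qg x2g] := irr_geN1_rational PQ Qx co.
have [Q'g | nQ'g] := boolP (g \in Q^`(1)).
  move: x2g; rewrite conjgE (centsP abQ' x) // mulKg => /(canRL (mulKg _)).
  by rewrite mulVg => ->; rewrite expg1n.
by rewrite expgS x2g metab_invert ?mulgV // inE nQ'g.
Qed.

Lemma metab_cent t : t \in Q :\: Q^`(1) -> #|'C_Q[t]| = 2.
Proof.
move=> QDt; have [Qt nQ't] := setDP QDt.
have tiC: 'C_Q[t] :&: Q^`(1) = 1.
  apply/trivgP/subsetP=> y /setIP[/setIP[_ /cent1P cty] Q'y].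
  have yt : y ^ t = y by apply/conjg_fixP/commgP.
  have y2 : y ^+ 2 = 1 by rewrite expg2 -{2}yt metab_invert ?mulgV.
  by apply/set1gP; rewrite -(metab_cube Q'y) expgS y2 mulg1.
apply/eqP; rewrite eqn_leq; apply/andP; split.
  rewrite -(leq_pmul2r (cardG_gt0 Q^`(1))) mul_cardG tiC cards1 muln1.
  rewrite -metab_index mulnC Lagrange ?der_sub //.
  by rewrite subset_leq_card // mulG_subG subsetIl der_sub.
rewrite cardG_gt1; apply/trivgPn; exists t; first by rewrite inE Qt cent1id.
by apply: contraNneq nQ't => ->.
Qed.

End Metabelian.

(** This is the metabelian case read in G / G^`(2). *)
Lemma irr_geN1_top (gT : finGroupType) (G : {group gT}) :
    irr_geN1 G -> solvable G -> ~~ abelian G ->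
  [/\ #|G : G^`(1)| = 2, forall g, g \in G :\: G^`(1) -> g ^+ 2 \in G^`(2),
      forall x g, x \in G^`(1) -> g \in G :\: G^`(1) -> x * x ^ g \in G^`(2)
    & forall x, x \in G^`(1) -> x ^+ 3 \in G^`(2)].
Proof.
move=> PG solG nabG.
have nsG2 : G^`(2) <| G := der_normal 2 G.
have [sG2 nG2] := andP nsG2.
have PQ : irr_geN1 (G / G^`(2))%G := irr_geN1_mod PG nsG2.
have defQ' : (G / G^`(2))^`(1) = G^`(1) / G^`(2) by rewrite -quotient_der.
have abQ' : abelian (G / G^`(2))^`(1) by rewrite defQ' der_abelian.
have sG21 : G^`(2) \subset G^`(1) by apply: der_subS.
have nG21 : G^`(1) \subset 'N(G^`(2)) := subset_trans (der_sub 1 G) nG2.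
have ntQ' : (G / G^`(2))^`(1) != 1.
  rewrite defQ'; apply: contra nabG => /eqP/trivgP.
  rewrite quotient_sub1 // => sG12.
  rewrite (sameP derG1P eqP); apply: contraT => ntG'.
  have /proper_subn : G^`(2) \proper G^`(1) := sol_der1_proper solG (der_sub 1 G) ntG'.
  by rewrite sG12.
have Gin g : g \in G -> g \in 'N(G^`(2)) by apply: subsetP.
have G'in x : x \in G^`(1) -> x \in G by apply: subsetP (der_sub 1 G) x.
have Qin g : g \in G -> (coset G^`(2) g \in (G / G^`(2))^`(1)) = (g \in G^`(1)).
  by move=> Gg; rewrite defQ' coset_in_quotient ?Gin.
have QDin g : g \in G :\: G^`(1) ->
    coset G^`(2) g \in (G / G^`(2)) :\: (G / G^`(2))^`(1).
  by case/setDP=> Gg nG'g; rewrite inE Qin // nG'g mem_quotient.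
split.
- rewrite -(metab_index PQ abQ' ntQ') defQ' index_quotient_eq ?der_sub //.
  by rewrite setIC (setIidPl _) ?subIset ?sG21.
- move=> g GDg; have [Gg _] := setDP GDg.
  by apply: coset_idr; rewrite ?morphX ?groupX ?Gin //= (metab_sqr PQ abQ' ntQ') ?QDin.
- move=> x g G'x GDg; have [[Gg _] Gx] := (setDP GDg, G'in x G'x).
  apply: coset_idr; first by rewrite groupM ?Gin ?groupJ.
  rewrite morphM ?morphJ ?Gin ?groupJ //=.
  by rewrite (metab_invert PQ abQ' ntQ') ?mulgV ?QDin ?Qin.
move=> x G'x; have Gx := G'in x G'x.
by apply: coset_idr; rewrite ?morphX ?groupX ?Gin //= (metab_cube PQ abQ' ntQ') ?Qin.
Qed.

(** * Derived length three *)

Lemma dl3_count_arith (v n : nat) :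
  (6 + 9 * n = 6 * v -> 2 * v + 4 = 3 * (2 + n))%N.
Proof. lia. Qed.

Lemma dl3_pow2_arith k a : 
  (0 < k -> 2 * 2 ^ k + 4 = 3 * 2 ^ a -> 2 ^ k = 4)%N.
Proof.
case: k => [|[|[|k]]] // _; rewrite !expnS ?expn0.
  by case: a => [|[|a]]; rewrite ?expnS ?expn0; lia.
by case: a => [|[|[|a]]]; rewrite ?expnS ?expn0; lia.
Qed.

Section DerivedLength3.

Variables (gT : finGroupType) (M : {group gT}).
Hypotheses (PM : irr_geN1 M) (solM : solvable M).
Hypotheses (abV : abelian M^`(2)) (ntV : M^`(2) != 1).

Lemma dl3_nonabelian : ~~ abelian M.
Proof.
apply: contra ntV => /derG1P M1.
by rewrite -subG1 -M1 der_subS.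
Qed.

Let V := M^`(2)%G.
Let nsVM : V <| M := der_normal 2 M.
Let sVM' : V \subset M^`(1) := der_subS 1 M.
Let sM'M : M^`(1) \subset M := der_sub 1 M.

Let iM : #|M : M^`(1)| = 2. Proof. by case: (irr_geN1_top PM solM dl3_nonabelian). Qed.
Let sqrM g : g \in M :\: M^`(1) -> g ^+ 2 \in V.
Proof. by case: (irr_geN1_top PM solM dl3_nonabelian) => _ + _ _; apply. Qed.
Let invM x g : x \in M^`(1) -> g \in M :\: M^`(1) -> x * x ^ g \in V.
Proof. by case: (irr_geN1_top PM solM dl3_nonabelian) => _ _ + _; apply. Qed.
Let cubM x : x \in M^`(1) -> x ^+ 3 \in V.
Proof. by case: (irr_geN1_top PM solM dl3_nonabelian) => _ _ _; apply. Qed.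

Lemma dl3_der1_quo : 3.-group (M^`(1) / V).
Proof.
rewrite -pnat_exponent (@pnat_dvd _ 3) //; apply/exponentP=> _ /morphimP[x Nx M'x ->].
by rewrite -morphX //= coset_id ?cubM.
Qed.

(** The prime 3 is excluded since the quotient of M^`(1) by the 3'-part of V is
    a normal 3-subgroup, hence abelian. For a prime p > 3 and x in V of order p,
    the group M acts on <[x]> through M / V, in which every element g has g ^+ 2
    = 1 or g ^+ 3 = 1, too little to induce an automorphism of order p - 1. *)
Lemma dl3_der2_2group : 2.-group V.
Proof.
have V3' : 3^'.-group V.
  pose K := 'O_3^'(V)%G.
  have chK: K \char V by apply: pcore_char.
  have nsKM: K <| M by apply: char_normal_trans chK nsVM.
  have [sKM nKM] := andP nsKM.
  have hallK: 3^'.-Hall(V) K by apply: nilpotent_pcore_Hall; apply: abelian_nil.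
  have [sKV oK iK] := and3P hallK.
  suffices sVK: V \subset K by apply: pgroupS oK.
  have nKM' := subset_trans sM'M nKM.
  apply: (der1_min nKM'); apply: (irr_geN1_pgroup_abelian (irr_geN1_mod PM nsKM) (isT : prime 3)).
    by apply: quotient_normal; apply: der_normal.
  rewrite /pgroup card_quotient // -(Lagrange_index sVM' sKV) pnatM.
  rewrite -card_quotient ?(subset_trans sM'M) ?der_norm // [3.-nat _]dl3_der1_quo /=.
  by rewrite (eq_pnat _ (negnK 3)) in iK.
apply/pgroupP=> p p_pr /(Cauchy p_pr)[x Vx ox]; rewrite inE /=.
have Mx : x \in M := subsetP (der_sub 2 M) x Vx.
have fixx y : y \in V -> x ^ y = x by move=> Vy; rewrite conjgE (centsP abV x) // mulKg.
have p3 : p != 3.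
  apply: contraTneq Vx => p3; apply/negP=> Vx.
  by have := mem_p_elt V3' Vx; rewrite /p_elt ox p3.
have [|g [Mg _ gen]] := irr_geN1_prime_gen PM Mx; first by rewrite ox.
rewrite ox in gen; have [M'g | nM'g] := boolP (g \in M^`(1)).
  have := gen 3 (fixx _ (cubM M'g)).
  by case: p p_pr p3 {ox gen} => [|[|[|[|[|p]]]]] // _ _ /dvdn_leq; apply.
have := gen 2 (fixx _ (sqrM _)); rewrite inE nM'g => /(_ Mg).
by case: p p_pr p3 {ox gen} => [|[|[|[|p]]]] // _ _ /dvdn_leq; apply.
Qed.

Lemma dl3_complement :
  exists2 A : {group gT}, V ><| A = M^`(1) & 3.-group A.
Proof.
have [A sylA] := Sylow_exists 3 M^`(1).
exists A; last by case/and3P: sylA.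
have nsVM' : V <| M^`(1) by apply: normalS nsVM.
apply/(sdprod_normal_p'HallP nsVM' (_ : (3^')^'.-Hall(_) A)).
  by rewrite (eq_pHall _ _ (negnK 3)).
rewrite /pHall sVM' /pgroup (sub_in_pnat _ dl3_der2_2group) /=; last by move=> p _ /eqP->.
rewrite -card_quotient ?normal_norm // (eq_pnat _ (negnK 3)); exact: dl3_der1_quo.
Qed.

(** A complement A of V in M^`(1) is elementary abelian. Were it noncyclic, some
    a != 1 in A would have nontrivial fixed points on V. Then B = <[a]> V is
    normal in M, since M normalizes <[a]> modulo V; in the quotient by [~: V, B]
    the image of B is abelian, with nontrivial 2-part and nontrivial odd part,
    both normal. *)
Lemma dl3_der1_index : #|M^`(1) : V| = 3.
Proof.
have [A defM' pA] := dl3_complement.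
have [_ mulVA nVA tiVA] := sdprodP defM'.
have sAM' : A \subset M^`(1) by rewrite -mulVA mulG_subr.
have coVA : coprime #|V| #|A| by apply: (pnat_coprime dl3_der2_2group); apply: sub_in_pnat pA => p _ /eqP->.
have abelA: 3.-abelem A.
  rewrite abelemE //; apply/andP; split; last first.
    apply/exponentP=> x Ax; apply/set1gP; rewrite -tiVA.
    by rewrite inE cubM ?groupX ?(subsetP sAM').
  by rewrite (sameP derG1P eqP) -subG1 -tiVA subsetI der_sub dergS.
have abA := abelem_abelian abelA.
rewrite -(index_sdprod defM'); apply: cyclic_abelem_prime abelA _ _; last first.
  apply: contraNneq ntV => A1; move: mulVA; rewrite A1 mulg1 => defV.
  by apply/eqP/derG1P; rewrite -defV.
apply: contraT => ncA.
have [a /setD1P[nt_a Aa]] := cent_noncyclic_abelian abA ncA nVA (abelian_sol abV) ntV.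
case/negP; rewrite -subG1 /=.
have sa_A : <[a]> \subset A by rewrite cycle_subG.
have nVa : <[a]> \subset 'N(V) := subset_trans sa_A nVA.
pose B := (<[a]> <*> V)%G; have defB : B :=: <[a]> * V by apply: norm_joinEl.
have M'a : a \in M^`(1) := subsetP sAM' a Aa.
have sVB : V \subset B by apply: joing_subr.
have Ba : a \in B by rewrite (subsetP (joing_subl _ _)) ?cycle_id.
have nsBM : B <| M.
  rewrite /normal join_subG cycle_subG (subsetP sM'M) // (normal_sub nsVM) /=.
  apply/subsetP=> g Mg; rewrite inE conjYg join_subG -cycleJ cycle_subG.
  rewrite (normsP (normal_norm nsVM)) // sVB andbT.
  have [M'g | nM'g] := boolP (g \in M^`(1)).
    by rewrite conjg_mulR groupM // (subsetP sVB) // mem_commg.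
  have: a * a ^ g \in B by rewrite (subsetP sVB) // invM // inE nM'g.
  by rewrite groupMl.
pose K := [~: V, B]%G.
have sKV : K \subset V by rewrite commg_subl (subset_trans (normal_sub nsBM)) ?normal_norm.
have nsKM : K <| M.
  by rewrite /normal (subset_trans sKV (normal_sub nsVM)) /= normsR ?normal_norm.
have [_ nKM] := andP nsKM.
(* So K is proper in V by coprime action, as a has nontrivial fixed points on V. *)
have defK : K :=: [~: V, <[a]>].
  rewrite /= [LHS]commGC defB commMG ?commg_normr //.
  by rewrite (commG1P (_ : V \subset 'C(V))) // mulg1 commGC.
have [sVK | nsVK] := boolP (V \subset K).
  rewrite -cent_cycle -(@coprime_abel_cent_TI _ <[a]> V) //.
    by rewrite setSI // -defK.
  by apply: coprimegS coVA.
have PR := irr_geN1_mod PM nsKM.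
have nKB : B \subset 'N(K) := subset_trans (normal_sub nsBM) nKM.
have nKV : V \subset 'N(K) := subset_trans sVB nKB.
have nKa : <[a]> \subset 'N(K) := subset_trans (joing_subl _ _) nKB.
have abBK : abelian (B / K).
  rewrite [B : {set _}]defB quotientMl // abelianM !quotient_abelian ?cycle_abelian //=.
  by rewrite quotient_cents2 // defK.
pose O := 'O_2^'(B / K)%G.
have nsOR : O <| M / K.
  by apply: char_normal_trans (pcore_char _ _) (quotient_normal _ _).
have hallO : 2^'.-Hall(B / K) O by apply: nilpotent_pcore_Hall; apply: abelian_nil.
have O1 : O :=: 1.
  apply: (irr_geN1_no_mixed PR (quotient_normal K nsVM) nsOR).
  - exact: quotient_pgroup dl3_der2_2group.
  - by rewrite odd_2'nat; case/and3P: hallO.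
  by rewrite -subG1 quotient_sub1.
have a2 : 2.-elt (coset K a).
  have [_ _] := and3P hallO; rewrite /= O1 indexg1 (eq_pnat _ (negnK 2)) => p2.
  by apply: (mem_p_elt (p2 : 2.-group (B / K))); rewrite mem_quotient.
have Na : a \in 'N(K) by rewrite -cycle_subG.
have a3 : 3.-elt (coset K a) by apply: morph_p_elt Na _; apply: mem_p_elt pA Aa.
case/eqP: nt_a; apply/set1gP; rewrite -tiVA inE Aa andbT (subsetP sKV) //.
apply: coset_idr => //; apply/eqP; rewrite -order_eq1; apply/eqP.
apply: (pnat_1 a2); apply: sub_in_pnat a3 => p _ /eqP->; exact: isT.
Qed.

Lemma dl3_card : #|M| = (6 * #|V|)%N.
Proof.
by rewrite -(Lagrange sM'M) -(Lagrange sVM') iM dl3_der1_index -mulnA mulnC.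
Qed.

(** The degree is odd by the congruence mod 2, divides |M| = 6 |V| and is not 1.
    *)
Lemma dl3_irr1 i : ~~ (V \subset cfker ('chi[M]_i)%R) -> ('chi_i 1%g = 3%:R)%R.
Proof.
move=> nkV; have /natrP[d Dd] := Cnat_irr1 i; rewrite Dd.
have odd_d : odd d.
  by have := irr1_modp PM (isT : prime 2) nsVM dl3_der2_2group nkV Dd; rewrite dvdn2 /= negbK.
have [k Dk] := p_natP dl3_der2_2group.
have: d %| 3 * 2 ^ k.+1.
  have := dvd_irr1_cardG i; rewrite Dd dvdC_nat dl3_card Dk expnS mulnA //.
rewrite Gauss_dvdl ?coprimeXr ?coprimen2 //; have [_ dP] := primeP (isT : prime 3).
move=> /dP/orP[]/eqP d1; rewrite d1 // in Dd *.
case/negP: nkV; apply: subset_trans sVM' _; apply: lin_char_der1.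
by rewrite qualifE /= irr_char Dd eqxx.
Qed.

Lemma dl3_2elt : exists2 t, t \in M :\: M^`(1) & 2.-elt t.
Proof.
have [S sylS] := Sylow_exists 2 M; have [sSM pS iS] := and3P sylS.
have [sSM' | /subsetPn[t St nM't]] := boolP (S \subset M^`(1)); last first.
  by exists t; [rewrite inE nM't (subsetP sSM) | apply: mem_p_elt St].
by have := pnat_dvd (indexgS M sSM') iS; rewrite iM.
Qed.

Lemma dl3_lin_sign t : t \in M :\: M^`(1) ->
  exists2 l, ('chi[M]_l)%R \is a linear_char & ('chi_l t = -1)%R.
Proof.
move=> MDt; have [Mt nM't] := setDP MDt.
have [l lin_l nkl]: exists2 l, ('chi[M]_l)%R \is a linear_char & t \notin cfker ('chi_l)%R.
  apply/exists_inP; apply: contraR nM't => /exists_inPn kert.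
  by rewrite -(cap_cfker_lin_irr M); apply/bigcapP=> l /kert/negbNE.
exists l => //; have: ('chi_l t ^+ 2 == 1)%R.
  rewrite -lin_charX // cfker1 ?lin_char1 //.
  exact: subsetP (lin_char_der1 lin_l) _ (subsetP sVM' _ (sqrM MDt)).
rewrite sqrf_eq1 => /orP[|/eqP//].
by rewrite cfkerEirr inE lin_char1 // in nkl; rewrite (negPf nkl).
Qed.

(** Let t be a 2-element outside M^`(1). Its centralizer is a 2-group. The
    characters of M / V contribute 2 to the sum of |chi t|^2 and 6 to the sum of
    chi(1)^2; the others have degree 3 and the value 1 or -1 at t. The
    orthogonality relations give 3 |C(t)| = 2 |V| + 4, where |C(t)| and |V| are
    powers of 2. *)
Lemma dl3_card_der2 : #|V| = 4.
Proof.
have [t MDt t2] := dl3_2elt; have [Mt nM't] := setDP MDt.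
have [l lin_l lt] := dl3_lin_sign MDt.
pose ker i := V \subset cfker ('chi[M]_i)%R.
have norm1 i : ~~ ker i -> (`|'chi_i t| ^+ 2 = 1)%R.
  move=> nki; have d3 := dl3_irr1 nki; have le1 := irr_geN1_norm_le1 PM i lin_l lt.
  have [n Dn] := PM i Mt.
  have n2 : n = 4 %[mod 2].
    apply: (@p_elt_char_nat _ M ('chi_i + 1)%R 2 t) => //.
    - by rewrite rpredD ?irr_char ?rpred1.
    - by rewrite !cfunE Dn cfun1E Mt subrK.
    by rewrite !cfunE d3 cfun1E group1 natr1.
  rewrite {}Dn in le1 *; case: n n2 le1 => [|[|[|n]]] // _.
  - by rewrite sub0r normrN1 expr1n.
  - by rewrite -natr1 addrK normr1 expr1n.
  by rewrite -natr1 addrK normr_nat (ler_nat _ _ 1).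
have sum_norm (rT : finGroupType) (G : {group rT}) x : x \in G ->
    (\sum_i `|'chi[G]_i x| ^+ 2 = #|'C_G[x]|%:R)%R.
  move=> Gx; have := second_orthogonality_relation x Gx; rewrite class_refl mulr1n => <-.
  by apply: eq_bigr => i _; rewrite normCK.
have nVM := normal_norm nsVM.
have PQ : irr_geN1 (M / V)%G := irr_geN1_mod PM nsVM.
have defQ' : (M / V)^`(1) = M^`(1) / V by rewrite -quotient_der.
have iQ : #|M / V| = 6.
  by rewrite card_quotient // -divgS ?normal_sub // dl3_card mulnK.
have cQ : #|'C_(M / V)[coset V t]| = 2.
  apply: (metab_cent PQ).
  - by rewrite defQ' der_abelian.
  - rewrite defQ' -cardG_gt1 card_quotient ?(subset_trans sM'M) //.
    by rewrite dl3_der1_index.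
  rewrite inE mem_quotient // andbT defQ'; apply: contra nM't.
  by rewrite coset_in_quotient // (subsetP nVM).
(* Eliminate the number n of characters that are nontrivial on V. *)
have eqC: (2 * #|V| + 4 = 3 * #|'C_M[t]|)%N.
  have eC := sum_norm _ M t Mt; have e1 := sum_norm _ M 1 (group1 M).
  rewrite (bigID ker) /= -(sum_norm_irr_quo Mt nsVM) sum_norm ?mem_quotient // cQ in eC.
  rewrite (bigID ker) /= -(sum_norm_irr_quo (group1 M) nsVM) sum_norm ?mem_quotient // in e1.
  rewrite morph1 !cent11T !setIT iQ dl3_card in e1.
  rewrite (eq_bigr (fun _ => 1%R)) // sumr_const -natrD in eC.
  rewrite (eq_bigr (fun _ => 9%:R)%R) ?sumr_const in e1; last first.
    by move=> i /dl3_irr1->; rewrite normr_nat -natrX.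
  set n := #|_| in eC e1.
  move/eqP: eC; rewrite eqr_nat => /eqP <-.
  move/eqP: e1; rewrite -mulrnA -natrD eqr_nat => /eqP e1.
  exact: dl3_count_arith e1.
(* An element of order 3 that commutes with t would be inverted by t modulo V. *)
have C3' : 3^'.-nat #|'C_M[t]|.
  apply/pgroupP=> p p_pr /(Cauchy p_pr)[x /setIP[Mx /cent1P ctx] ox].
  rewrite inE /=; apply/eqP=> p3; rewrite {}p3 {p p_pr} in ox.
  have M'x : x \in M^`(1).
    have -> : x = (x ^+ 2) ^+ 2 by rewrite -expgM [_ ^+ _]expgS -ox expg_order mulg1.
    by rewrite groupX // irr_geN1_sqr_der1.
  have xt : x ^ t = x by apply/conjg_fixP/commgP.
  have Vx : x ^+ 2 \in V by rewrite expg2 -{2}xt invM.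
  have := order_dvdG Vx; rewrite orderXgcd ox /= => V3.
  by have := pnat_dvd V3 dl3_der2_2group.
have [k Dk] := p_natP dl3_der2_2group.
have [a Da]: exists a, #|'C_M[t]| = (2 ^ a)%N.
  suffices /p_natP[a ->]: 2.-nat #|'C_M[t]| by exists a.
  have: #|'C_M[t]| %| 3 * 2 ^ k.+1.
    by rewrite expnS mulnA -Dk -dl3_card cardSg ?subsetIl.
  rewrite Gauss_dvdr; first by move/pnat_dvd; apply; rewrite pnatX.
  by apply: (@pnat_coprime 3^' _ _ C3'); rewrite pnatNK.
have k_gt0 : 0 < k.
  by rewrite lt0n; apply: contra ntV => /eqP k0; rewrite (trivg_card1 V) Dk k0.
rewrite Dk; apply: dl3_pow2_arith k_gt0 (_ : _ = 3 * 2 ^ a)%N.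
by rewrite -Dk eqC Da.
Qed.

Lemma dl3_order3 (H : {group gT}) : H \subset M -> 3 %| #|H| ->
  exists2 x, x \in H & (x \in M^`(1)) && (x \notin V).
Proof.
move=> sHM /(Cauchy (isT : prime 3))[x Hx ox]; exists x => //.
apply/andP; split.
  have -> : x = (x ^+ 2) ^+ 2 by rewrite -expgM [_ ^+ _]expgS -ox expg_order mulg1.
  by rewrite groupX // irr_geN1_sqr_der1 // (subsetP sHM).
by apply/negP=> /order_dvdG; rewrite ox dl3_card_der2.
Qed.

Section KleinSubgroup.

Variable Z : {group gT}.
Hypotheses (sZV : Z \subset V) (oZ : #|Z| = 2).

(** Otherwise Z is normal in M^`(1), whose complement A of V centralizes the
    groups Z and V / Z of order 2; by coprime action A centralizes V, and M^`(1)
    is abelian. *)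
Lemma dl3_norm_der1 : 'N_(M^`(1))(Z) \subset V.
Proof.
have nsVM' : V <| M^`(1) by apply: normalS nsVM.
have sVN : V \subset 'N_(M^`(1))(Z).
  by rewrite subsetI sVM' cents_norm // (subset_trans abV) ?centS.
apply: contraT => nsNV; have eqN : 'N_(M^`(1))(Z) = M^`(1).
  apply: (@prime_index_maximal _ M^`(1)%G V 'N_(M^`(1))(Z)%G) => //.
    by rewrite dl3_der1_index.
  exact: subsetIl.
have nZM' : M^`(1) \subset 'N(Z) by rewrite -eqN subsetIr.
have [A defM' pA] := dl3_complement.
have [_ mulVA nVA tiVA] := sdprodP defM'.
have sAM' : A \subset M^`(1) by rewrite -mulVA mulG_subr.
have coVA : coprime #|V| #|A| by apply: (pnat_coprime dl3_der2_2group); apply: sub_in_pnat pA => p _ /eqP->.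
(* V / Z has order 2, so A centralizes it. *)
have sVA_Z : [~: V, A] \subset Z.
  have nZA := subset_trans sAM' nZM'; have nZV := subset_trans sVM' nZM'.
  rewrite commGC -quotient_cents2 //; apply: card2_cents.
    by rewrite card_quotient // -divgS // dl3_card_der2 oZ.
  exact: quotient_norms.
have VA1 : [~: V, A] = 1.
  apply/trivgP; rewrite -(coprime_abel_cent_TI nVA coVA abV) subsetI subxx /=.
  apply: subset_trans sVA_Z _; rewrite centsC; apply: card2_cents oZ _.
  exact: subset_trans nZM'.
case/eqP: ntV; apply/derG1P; rewrite -mulVA abelianM [abelian V]abV /=.
have -> : abelian A.
  by rewrite (sameP derG1P eqP) -subG1 -tiVA subsetI der_sub dergS.
by rewrite centsC; apply/commG1P.
Qed.

(** If g lies outside M^`(1) and g ^+ 2 is not in Z, then g centralizes V = <Z,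
    g ^+ 2>. The commutators of g with M^`(1) then lie in the centralizer of V
    in M^`(1), which is V, whereas g inverts M^`(1) / V, of order 3. *)
Lemma dl3_norm_sqr g : g \in 'N_M(Z) -> g ^+ 2 \in Z.
Proof.
case/setIP=> Mg nZg; have nZV : V \subset 'N(Z).
  by rewrite cents_norm // (subset_trans abV) ?centS.
have [M'g | nM'g] := boolP (g \in M^`(1)).
  have Vg : g \in V by apply: (subsetP dl3_norm_der1); rewrite inE M'g.
  apply: coset_idr; rewrite ?groupX // morphX //= -[2](_ : #|V / Z| = 2) ?expg_cardG ?mem_quotient //.
  by rewrite card_quotient // -divgS // dl3_card_der2 oZ.
have MDg : g \in M :\: M^`(1) by rewrite inE nM'g.
have Vg2 := sqrM MDg; apply: contraT => nZg2.
have sg2V : <[g ^+ 2]> \subset V by rewrite cycle_subG.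
have defV : Z <*> <[g ^+ 2]> = V.
  apply: (@prime_index_maximal _ V Z (Z <*> <[g ^+ 2]>)%G).
  - by rewrite -divgS // dl3_card_der2 oZ.
  - exact: joing_subl.
  - by rewrite join_subG sZV.
  by rewrite join_subG subxx cycle_subG.
have cVg : g \in 'C(V).
  rewrite -defV centY inE -cycle_subG card2_cents ?cycle_subG //=.
  by rewrite cent_cycle; apply/cent1P; apply: commuteX.
have sCV : 'C_(M^`(1))(V) \subset V.
  apply: subset_trans dl3_norm_der1; rewrite setIS // cents_norm // centS //.
have [|x _ /andP[M'x /negP[]]] := dl3_order3 (subxx M).
  by rewrite dl3_card dl3_card_der2.
have Mx := subsetP sM'M x M'x; have nM'g' := subsetP (der_norm 1 M) g Mg.
have Vxg : [~ x, g] \in V.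
  apply: (subsetP sCV); rewrite inE commgEl groupM ?groupV ?memJ_norm //=.
  rewrite -commgEl commgEr groupM // memJ_norm ?groupV //.
  exact: subsetP (norms_cent (normal_norm nsVM)) x Mx.
have Vx2 : x ^+ 2 \in V.
  by have := invM M'x MDg; rewrite conjg_mulR mulgA groupMr.
by have := cubM M'x; rewrite expgSr groupMl.
Qed.

Lemma dl3_norm_index : 3 %| #|M : 'N_M(Z)|.
Proof.
have : 3 %| #|M| by rewrite dl3_card dl3_card_der2.
rewrite -(Lagrange (subsetIl M 'N(Z))) Euclid_dvdM // => /orP[|//].
case/(dl3_order3 (subsetIl _ _)) => x /setIP[_ Nx] /andP[M'x /negP[]].
by apply: (subsetP dl3_norm_der1); rewrite inE M'x.
Qed.

End KleinSubgroup.

(** A cyclic V would have a single subgroup of order 2, normal in M. *)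
Lemma dl3_der2_ncyclic : ~~ cyclic V.
Proof.
apply/negP=> cycV; pose Z := 'Ohm_1(V)%G.
have oZ : #|Z| = 2 by apply: (Ohm1_cyclic_pgroup_prime cycV dl3_der2_2group).
have := dl3_norm_index (Ohm_sub 1 V) oZ.
have nZM : M \subset 'N(Z) := gFnorm_trans _ (normal_norm nsVM).
by rewrite (setIidPl nZM) indexgg.
Qed.

End DerivedLength3.

(** * Derived length four *)

Section DerivedLength4.

Variables (gT : finGroupType) (G : {group gT}).
Hypotheses (PG : irr_geN1 G) (solG : solvable G).
Hypotheses (abN : abelian G^`(3)) (ntN : G^`(3) != 1).

Let N := G^`(3)%G.
Let L := G^`(2)%G.
Let M := (G / N)%G.

Let nsNG : N <| G := der_normal 3 G.
Let nNG : G \subset 'N(N) := normal_norm nsNG.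
Let nsLG : L <| G := der_normal 2 G.
Let sLG : L \subset G := normal_sub nsLG.
Let sNL : N \subset L := der_subS 2 G.
Let nNL : L \subset 'N(N) := subset_trans sLG nNG.
Let PM : irr_geN1 M := irr_geN1_mod PG nsNG.
Let solM : solvable M := quotient_sol N solG.
Let defV : M^`(2) = L / N. Proof. by rewrite -quotient_der. Qed.
Let abV : abelian M^`(2). Proof. by rewrite defV der_abelian. Qed.
Let ntV : M^`(2) != 1.
Proof.
rewrite defV; apply/eqP=> /trivgP; rewrite quotient_sub1 // => sLN.
have ntL : L :!=: 1 by apply: contraNneq ntN => L1; rewrite -subG1 -L1.
have /proper_subn/negP[] : N \proper L := sol_der1_proper solG (der_sub 2 G) ntL.
exact: sLN.
Qed.
Let oV : #|L / N| = 4. Proof. by rewrite -defV; apply: dl3_card_der2. Qed.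

(** Modulo the odd part of N, the subgroup L is a normal 2-subgroup, hence
    abelian. *)
Lemma dl4_der3_odd : odd #|N|.
Proof.
rewrite odd_2'nat; pose K := 'O_2^'(N)%G.
have chK: K \char N by apply: pcore_char.
have nsKG: K <| G by apply: char_normal_trans chK nsNG.
have [sKG nKG] := andP nsKG.
have hallK: 2^'.-Hall(N) K by apply: nilpotent_pcore_Hall; apply: abelian_nil.
have [sKN oK iK] := and3P hallK.
suffices sNK: N \subset K by apply: pgroupS oK.
have nKL := subset_trans sLG nKG.
apply: (der1_min nKL); apply: (irr_geN1_pgroup_abelian (irr_geN1_mod PG nsKG) (isT : prime 2)).
  exact: quotient_normal nsLG.
rewrite /pgroup card_quotient // -(Lagrange_index sNL sKN) pnatM.
by rewrite -card_quotient // oV; rewrite (eq_pnat _ (negnK 2)) in iK.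
Qed.

(** W is a Sylow 2-subgroup of L; since L / [~: N, W] is abelian, N = [~: N, W].
    *)
Lemma dl4_klein_complement : exists W : {group gT},
  [/\ N ><| W = L, abelian W, ~~ cyclic W, [~: N, W] = N & 'C_N(W) = 1].
Proof.
have [W sylW] := Sylow_exists 2 L; have [sWL pW _] := and3P sylW.
have nsNL : N <| L by apply: normalS nsNG.
have defL : N ><| W = L.
  apply/(sdprod_normal_p'HallP nsNL (_ : (2^')^'.-Hall(_) W)).
    by rewrite (eq_pHall _ _ (negnK 2)).
  rewrite /pHall sNL /pgroup -odd_2'nat dl4_der3_odd /= -card_quotient // oV.
  by rewrite (eq_pnat _ (negnK 2)).
have [_ mulNW nNW tiNW] := sdprodP defL.
have abW : abelian W.
  by rewrite (sameP derG1P eqP) -subG1 -tiNW subsetI der_sub dergS.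
have NW : [~: N, W] = N.
  apply/eqP; rewrite eqEsubset commg_subl nNW /=.
  have nKL : L \subset 'N([~: N, W]) by rewrite -mulNW mulG_subG commg_norml commg_normr.
  apply: (der1_min nKL); rewrite -[X in X / _]mulNW.
  have nKN := subset_trans sNL nKL; have nKW := subset_trans sWL nKL.
  rewrite quotientMl // abelianM !quotient_abelian //=.
  by rewrite quotient_cents2 // commGC.
exists W; split=> //.
  apply: contra (dl3_der2_ncyclic PM solM abV ntV) => cW.
  by rewrite /= defV -[L : {set _}]mulNW quotientMidl quotient_cyclic.
rewrite -{1}NW; apply: coprime_abel_cent_TI => //.
by rewrite coprime_sym (pnat_coprime pW) // -odd_2'nat dl4_der3_odd.
Qed.

(** V = L / N has order 4. *)
Lemma dl4_card_between (Z : {group gT}) :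
    N \subset Z -> Z \subset L -> ~~ (Z \subset N) -> ~~ (L \subset Z) ->
  #|Z / N| = 2.
Proof.
move=> sNZ sZL nsZN nsLZ; have nNZ := subset_trans sZL nNL.
have : #|Z / N| %| 4 by rewrite -oV cardSg ?quotientS.
have nt : #|Z / N| != 1%N.
  by rewrite -trivg_card1 -subG1 quotient_sub1.
have nf : #|Z / N| != 4.
  apply: contra nsLZ => /eqP oZ; rewrite -(quotientSGK nNL sNZ).
  by rewrite (_ : L / N = Z / N) //; apply/esym/eqP; rewrite eqEcard quotientS // oV oZ.
by move: nt nf; move: #|_| => [|[|[|[|[|m]]]]] // _ _ /dvdn_leq/(_ isT).
Qed.

(** Choose z != 1 in W with a fixed point w of prime order p in N; W does not
    centralize w, so Z = 'C_L(<[w]>) lies strictly between N and L. An element g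
    inducing a generator of the automorphism group of <[w]> normalizes Z, so g
    ^+ 2 lies in Z and centralizes w; thus p - 1 divides 2. *)
Lemma dl4_der3_3group : 3.-group N.
Proof.
have [W [defL abW ncW _ cNW]] := dl4_klein_complement.
have [_ mulNW nNW tiNW] := sdprodP defL.
have sWL : W \subset L by rewrite -mulNW mulG_subr.
apply/pgroupP=> p p_pr pN; rewrite inE /=.
pose P := 'O_p(N)%G.
have hallP: p.-Hall(N) P by apply: nilpotent_pcore_Hall; apply: abelian_nil.
have sPN : P \subset N by apply: pcore_sub.
have ntP : P :!=: 1.
  rewrite -cardG_gt1 (card_Hall hallP) p_part_gt1.
  by rewrite mem_primes p_pr cardG_gt0 pN.
have nPW : W \subset 'N(P) by apply: gFnorm_trans.
have [z /setD1P[nt_z Wz] ntC] :=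
  cent_noncyclic_abelian abW ncW nPW (solvableS sPN (abelian_sol abN)) ntP.
have pC : p.-group 'C_P[z] by apply: pgroupS (pHall_pgroup hallP); apply: subsetIl.
have [_ pCd _] := pgroup_pdiv pC ntC.
have [w /setIP[Pw /cent1P cwz] ow] := Cauchy p_pr pCd.
have Nw := subsetP sPN w Pw; have Gw := subsetP (normal_sub nsNG) w Nw.
have nt_w : w != 1 by rewrite -order_gt1 ow prime_gt1.
pose Z := 'C_L(<[w]>)%G.
have sZL : Z \subset L := subsetIl _ _.
have sNZ : N \subset Z by rewrite subsetI sNL (sub_abelian_cent2 abN) ?cycle_subG.
have oZ : #|Z / N| = 2.
  apply: dl4_card_between => //.
    apply: contra nt_z => sZN; apply/eqP/set1gP; rewrite -tiNW inE Wz andbT.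
    apply: (subsetP sZN); rewrite inE (subsetP sWL) //= cent_cycle.
    exact/cent1P.
  apply: contra nt_w => sLZ; apply/eqP/set1gP; rewrite -cNW inE Nw /=.
  rewrite -cycle_subG centsC; apply: subset_trans (subsetIr L _).
  exact: subset_trans sLZ.
have [|g [Gg wg gen]] := irr_geN1_prime_gen PG Gw; first by rewrite ow.
have nZg : g \in 'N(Z).
  have nwg : g \in 'N(<[w]>) by rewrite inE -cycleJ cycle_subG.
  have sNwZ : 'N_G(<[w]>) \subset 'N(Z).
    by rewrite normsI ?norms_cent ?subsetIr // (subset_trans (subsetIl _ _)) ?normal_norm.
  by apply: (subsetP sNwZ); rewrite inE Gg.
have Ng : g \in 'N(N) := subsetP nNG g Gg.
have Zg2 : g ^+ 2 \in Z.
  rewrite -(coset_in_quotient sNZ) ?groupX // morphX //=.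
  apply: (dl3_norm_sqr PM solM abV ntV (Z := (Z / N)%G)) => //.
    by rewrite /= defV quotientS.
  by rewrite inE mem_quotient //= (subsetP (quotient_norm _ _)) ?mem_quotient.
have wg2 : w ^ (g ^+ 2) = w.
  case/setIP: Zg2 => _; rewrite /= cent_cycle => /cent1P cwg.
  by apply/conjg_fixP/commgP.
have := gen 2 wg2; rewrite ow => p2.
have odd_p : odd p := dvdn_odd pN dl4_der3_odd.
by case: p p_pr odd_p p2 {ow pN P hallP sPN ntP nPW ntC pC pCd Pw gen} => [|[|[|[|p]]]] // _ _ /dvdn_leq; apply.
Qed.

(** Choose z != 1 in W with nontrivial fixed points on N, and a nonprincipal
    character 'chi_l of N trivial on [~: N, <[z]>]. Its inertia group T contains
    z but not W, because N = [~: N, W], so T normalizes a subgroup strictly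
    between N and L and its index in G is divisible by 3. *)
Lemma dl4_false : False.
Proof.
have [W [defL abW ncW NW cNW]] := dl4_klein_complement.
have [_ mulNW nNW tiNW] := sdprodP defL.
have sWL : W \subset L by rewrite -mulNW mulG_subr.
have coNW : coprime #|N| #|W|.
  have := dl4_der3_odd; rewrite -coprime2n coprime_sym => coN2.
  have -> : #|W| = (2 ^ 2)%N.
    rewrite -[RHS]oV card_quotient // -(index_sdprod defL) //.
  by rewrite coprimeXr.
have [z /setD1P[nt_z Wz] ntC] :=
  cent_noncyclic_abelian abW ncW nNW (abelian_sol abN) ntN.
have szW : <[z]> \subset W by rewrite cycle_subG.
pose K := [~: N, <[z]>]%G.
have nNz : <[z]> \subset 'N(N) := subset_trans szW nNW.
have sKN : K \subset N by rewrite commg_subl.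
have nsKN : K <| N by rewrite /normal sKN cents_norm // (subset_trans abN) ?centS.
have ntNK : N / K != 1.
  apply: contra ntC => /eqP/trivgP; rewrite quotient_sub1 ?normal_norm // => sNK.
  rewrite -subG1 /= -cent_cycle -(coprime_abel_cent_TI nNz (coprimegS szW coNW) abN).
  exact: setSI.
have [j nkj] := mem_irr_kerPn (subxx (N / K)%G) ntNK.
pose l := @mod_Iirr _ N K j.
have kerK : K \subset cfker ('chi_l)%R by rewrite mod_IirrE // cfker_mod.
have nkl : ~~ (N \subset cfker ('chi_l)%R).
  apply: contra nkj => kN; rewrite subGcfker -(mod_Iirr_eq0 _ nsKN) -/l.
  by rewrite -subGcfker.
have lin_l : ('chi_l)%R \is a linear_char by apply/char_abelianP.
pose T := 'I_G[('chi_l)%R]%G.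
have sTG : T \subset G := Inertia_sub _ _.
have sNT : N \subset T := sub_Inertia _ (normal_sub nsNG).
have Tz : z \in T.
  rewrite inE (subsetP sLG) ?(subsetP sWL) //= inE (subsetP nNW) //=.
  apply/eqP/cfun_inP=> n Nn; rewrite cfConjgE ?(subsetP nNW) // conjg_mulR.
  apply: cfkerMr; apply: (subsetP kerK).
  by rewrite mem_commg ?groupV ?cycle_id.
have nsLT : ~~ (L \subset T).
  apply: contra nkl => sLT; suffices: [~: N, W] \subset cfker ('chi_l)%R by rewrite NW.
  rewrite gen_subG.
  apply/subsetP=> _ /imset2P[n y Nn Wy ->].
  have Ty : y \in 'I[('chi_l)%R].
    by case/setIP: (subsetP sLT y (subsetP sWL y Wy)).
  have Nny : n ^ y \in N by rewrite memJ_norm // (subsetP nNW).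
  rewrite /= cfkerEirr inE commgEl lin_charM ?groupV // inertia_valJ //.
  by rewrite -lin_charM ?groupV // mulVg.
pose Z := (T :&: L)%G.
have sZL : Z \subset L := subsetIr _ _.
have sNZ : N \subset Z by rewrite subsetI sNT.
have oZ : #|Z / N| = 2.
  apply: dl4_card_between => //.
    apply: contra nt_z => sZN; apply/eqP/set1gP; rewrite -tiNW inE Wz andbT.
    by apply: (subsetP sZN); rewrite inE Tz (subsetP sWL).
  by apply: contra nsLT => sLZ; apply: subset_trans sLZ (subsetIl _ _).
have nZT : T \subset 'N(Z) by rewrite normsI ?normG // (subset_trans sTG) ?normal_norm.
have iT : 3 %| #|G : T|.
  have sZV : Z / N \subset M^`(2) by rewrite defV quotientS.
  apply: dvdn_trans (dl3_norm_index PM solM abV ntV (Z := (Z / N)%G) sZV oZ) _.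
  have iTE : #|M : T / N| = #|G : T|.
    by apply: index_quotient_eq => //; apply: subset_trans (subsetIr _ _) sNT.
  rewrite -iTE indexgS // subsetI quotientS //=.
  exact: subset_trans (quotientS _ nZT) (quotient_norm _ _).
have [i] := constt_cfInd_irr l (normal_sub nsNG); rewrite constt_Ind_Res => il.
have /natrP[d Dd] := Cnat_irr1 i.
have d3 : 3 %| d := dvdn_trans iT (dvdn_index_Inertia nsNG il Dd).
have nki : ~~ (N \subset cfker ('chi_i)%R).
  apply: contra nkl => kN.
  have charN : ('Res[N] 'chi_i)%R \is a character by rewrite cfRes_char ?irr_char.
  apply: subset_trans (cfker_constt charN il).
  by rewrite cfker_Res ?irr_char ?(normal_sub nsNG) // subsetI subxx.
have := irr1_modp PG (isT : prime 3) nsNG dl4_der3_3group nki Dd.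
by rewrite -[d.+1]addn1 (dvdn_addr _ d3).
Qed.

End DerivedLength4.

(** * Groups with two character values that are not degrees *)

(** Some nonlinear character takes the value 0 by Burnside's theorem, and a
    value a != 1 of a linear character is no degree either, having modulus 1.
    Hence cdc G = {0, a}; as a ^+ 2 is a value too, it is 1 or a, and a = -1. *)
Lemma size_cdc2_irr_geN1 (gT : finGroupType) (G : {group gT}) :
  solvable G -> ~~ abelian G -> size (cdc G) = 2 -> irr_geN1 G.
Proof.
move=> solG nabG sz2.
have cd0 : 0%R \in cdc G.
  have [i nlin_i]: exists i, ~~ (('chi[G]_i)%R \is a linear_char).
    apply/existsP; apply: contraR nabG; rewrite negb_exists => /forallP lin.
    by apply/char_abelianP=> i; apply: negbNE (lin i).
  have [|x Gx chi0] := @nonlinear_irr_vanish _ G i.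
    have /natrP[d Dd] := Cnat_irr1 i; have := irr1_gt0 i.
    move: nlin_i; rewrite qualifE /= irr_char Dd /= pnatr_eq1 ltr0n ltr1n.
    by case: d {Dd} => [|[]].
  rewrite mem_cdc; apply/andP; split; first by apply/cvP; exists i, x.
  by apply/cdP=> -[j]; apply/eqP; rewrite eq_sym irr1_neq0.
have cdc_lin l g : g \in G -> ('chi[G]_l)%R \is a linear_char ->
    ('chi_l g != 1)%R -> ('chi_l g)%R \in cdc G.
  move=> Gg lin_l; rewrite mem_cdc => nt_g; apply/andP; split; first by apply/cvP; exists l, g.
  apply: contra nt_g => /cdP[j Dj]; have /natrP[d Dd] := Cnat_irr1 j.
  have := normC_lin_char lin_l Gg; rewrite Dj Dd normr_nat => ->; exact: eqxx.
have [l [lin_l [g Gg nt_g]]]: exists l, ('chi[G]_l)%R \is a linear_char /\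
    exists2 g, g \in G & ('chi_l g != 1)%R.
  have ntG : G :!=: 1 by apply: contraNneq nabG => ->; apply: abelian1.
  have /subsetPn[g Gg] := proper_subn (sol_der1_proper solG (subxx G) ntG).
  rewrite -(cap_cfker_lin_irr G) => G'g.
  have [l lin_l nkl]: exists2 l, ('chi[G]_l)%R \is a linear_char & g \notin cfker ('chi_l)%R.
    apply/exists_inP; apply: contraR G'g => /exists_inPn kerg.
    by apply/bigcapP=> l /kerg/negbNE.
  by exists l; split=> //; exists g => //; rewrite cfkerEirr inE lin_char1 in nkl.
set a := ('chi_l g)%R in nt_g.
have cda : a \in cdc G by apply: cdc_lin.
have nz_a : (a != 0)%R by apply: lin_char_neq0.
have cdcE : [:: 0%R; a] =i cdc G.
  apply: (uniq_min_size _ _ _).2; rewrite ?sz2 //= ?andbT ?inE 1?eq_sym //.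
  by move=> x; rewrite !inE => /orP[] /eqP->.
have a1 : (a = -1)%R.
  apply/eqP; have : (a ^+ 2 == 1)%R; last by rewrite sqrf_eq1 (negPf nt_g).
  apply: contraT => nt_a2.
  have : (a ^+ 2)%R \in cdc G.
    by rewrite -lin_charX // cdc_lin ?groupX // lin_charX.
  rewrite -cdcE !inE sqrf_eq0 (negPf nz_a) /= expr2 -[X in (_ == X)%R]mulr1.
  by rewrite (inj_eq (mulfI nz_a)) (negPf nt_g).
move=> i x Gx; have [/cdP[j ->] | ncd] := boolP (('chi_i x)%R \in cd G).
  by have /natrP[d ->] := Cnat_irr1 j; exists d.+1; rewrite -natr1 addrK.
have : ('chi_i x)%R \in cdc G.
  by rewrite mem_cdc ncd andbT; apply/cvP; exists i, x.
rewrite -cdcE !inE a1 => /orP[] /eqP->; first by exists 1%N; rewrite subrr.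
by exists 0%N; rewrite sub0r.
Qed.

Lemma size_cdc2_derived_length (gT : finGroupType) (G : {group gT}) :
  solvable G -> size (cdc G) = 2%N -> derived_length G <> 4%N.
Proof.
move=> solG sz2 /(derived_lengthP _ solG)[G4 /(_ 3 isT) ntG3].
have nabG : ~~ abelian G.
  apply: contra ntG3 => /derG1P G1.
  by rewrite -subG1 -G1 (subset_trans (der_subS 2 G)) ?der_subS.
by apply: (dl4_false (size_cdc2_irr_geN1 solG nabG sz2) solG) ntG3; apply/derG1P.
Qed.

Local Open Scope ring_scope.

Theorem mainTheorem6 (gT : finGroupType) (G : {group gT}) :
  solvable G ->
  size (cdc G) = 2%N ->
  derived_length G = 4%N ->
  [/\ exists N : {group gT},
        [/\ N <| G, abelian N, 3%N.-group N & (G / N)%g \isog 'Sym_('I_4)],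
      {subset cd G <= [:: 1; 2; 3; 4; 6; 8; 12]},
      exists2 g, g \in G & #[g] = 6%N &
      exists i : Iirr G, 'chi_i 1%g = 6 \/ 'chi_i 1%g = 12].
Proof. by move=> solG sz2 /(size_cdc2_derived_length solG sz2). Qed.
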